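(* Let $D$ be a finite acyclic digraph and let $\overline{D}$ be its complement. Then the number of Hamiltonian paths on $\overline{D}$ is equal to the number of cycle covers of $\overline{D}$.
   Context: A digraph consists of a finite vertex set $V$ and an arrow set which is a subset of $V\times V$; loops $(v,v)$ are allowed but multiple arrows are not. The complement $\overline{D}$ has vertex set $V$ and contains an arrow $e\in V\times V$ (loops included) if and only if $D$ does not contain $e$. A path (resp. cycle) on $D$ is a subdigraph of $D$ that is a directed path (resp. directed cycle) never using a vertex twice; a path may be a single vertex, and a cycle may be a single loop. $D$ is acyclic if there are no cycles on $D$ (in particular no loops). A Hamiltonian path is a path passing through every vertex. A cycle cover of $D$ is a spanning subdigraph of $D$ (same vertex set) that is a disjoint union of cycles on $D$ such that every vertex lies in exactly one cycle. *)

(* Defs.v *)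
From mathcomp Require Import all_boot.
Set Implicit Arguments. Unset Strict Implicit. Unset Printing Implicit Defensive.

(* A digraph on the vertex type V is its arrow set D : {set V * V}. *)

Definition complement (V : finType) (D : {set V * V}) : {set V * V} := ~: D.

(* A subdigraph is a pair (vertex set, arrow set). *)
Definition subdigraph (V : finType) := ({set V} * {set V * V})%type.

(* For s = [:: v1; ...; vk]: the arrows (v1,v2), ..., (v(k-1),vk); there are
   none when k <= 1. *)
Definition path_arrows (V : finType) (s : seq V) : {set V * V} :=
  [set a in zip s (behead s)].

(* The same arrows together with (vk,v1); this is the loop (v1,v1) when k = 1. *)
Definition cycle_arrows (V : finType) (s : seq V) : {set V * V} :=
  [set a in zip s (rot 1 s)].

(* As s lists the vertices of S without repetition, its length can only be the
   number of vertices of S.  The empty path is allowed: this matters only for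
   the digraph without vertices, whose only Hamiltonian path is the empty one
   (and whose only cycle cover is the empty one). *)
Definition is_path (V : finType) (S : subdigraph V) : bool :=
  [exists s : #|S.1|.-tuple V,
    [&& uniq s, S.1 == [set v in s] & S.2 == path_arrows s]].

Definition is_cycle (V : finType) (S : subdigraph V) : bool :=
  (S.1 != set0) &&
  [exists s : #|S.1|.-tuple V,
    [&& uniq s, S.1 == [set v in s] & S.2 == cycle_arrows s]].

Definition path_on (V : finType) (D : {set V * V}) (S : subdigraph V) : bool :=
  is_path S && (S.2 \subset D).

Definition cycle_on (V : finType) (D : {set V * V}) (S : subdigraph V) : bool :=
  is_cycle S && (S.2 \subset D).

Definition acyclic (V : finType) (D : {set V * V}) : Prop :=
  forall C : subdigraph V, ~~ cycle_on D C.

Definition hamiltonian_path_on (V : finType) (D : {set V * V})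
    (S : subdigraph V) : bool :=
  path_on D S && (S.1 == [set: V]).

Definition cycle_cover_of (V : finType) (D : {set V * V})
    (S : subdigraph V) : bool :=
  [&& S.1 == [set: V], S.2 \subset D &
   [exists P : {set subdigraph V},
     [&& [forall C in P, cycle_on D C],
         [forall v : V, #|[set C in P | v \in C.1]| == 1],
         S.1 == \bigcup_(C in P) C.1 &
         S.2 == \bigcup_(C in P) C.2]]].

(* Main.v *)
(* Since D is acyclic, V has a linear order in which every arrow of D decreases,
   so that the complement of D contains every weakly increasing arrow.  Cut a
   word listing V after each of its right-to-left minima and close each block
   into a cycle (Foata's correspondence).  The arrows lost at the cuts leave a
   right-to-left minimum, and the arrows added go from the minimum of a block to
   its first letter, so all of them are weakly increasing: the word is a path in
   the complement iff the permutation is contained in it.  The first letter is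
   the image of the global minimum, which lets one decode the word from left to
   right; both sides have #|V|! elements, so injectivity is enough. *)

Require Import Defs.
From mathcomp Require Import all_boot.
From mathcomp Require Import perm.
Set Implicit Arguments. Unset Strict Implicit. Unset Printing Implicit Defensive.

(** * Lists of pairs with distinct coordinates *)

Lemma mem_pair_inj1 (S T : eqType) (l : seq (S * T)) x y y' :
  uniq (unzip1 l) -> (x, y) \in l -> (x, y') \in l -> y = y'.
Proof.
elim: l => //= [[u w]] l IH /andP[ul Ul]; rewrite !inE.
have notin z : (u, z) \notin l.
  by apply: contra ul => ulz; apply/mapP; exists (u, z).
case/orP=> [/eqP[-> ->]|xl] /orP[/eqP|xl'].
- by case.
- by rewrite (negPf (notin _)) in xl'.
- by case=> xu _; rewrite xu (negPf (notin _)) in xl.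
- exact: IH.
Qed.

Lemma mem_pair_inj2 (S T : eqType) (l : seq (S * T)) x x' y :
  uniq (unzip2 l) -> (x, y) \in l -> (x', y) \in l -> x = x'.
Proof.
move=> Ul xl xl'.
apply: (@mem_pair_inj1 _ _ [seq (p.2, p.1) | p <- l] y).
- by rewrite /unzip1 -map_comp.
- by apply/mapP; exists (x, y).
- by apply/mapP; exists (x', y).
Qed.

Lemma mem_zip1 (S T : eqType) (s : seq S) (t : seq T) x y :
  (x, y) \in zip s t -> x \in s.
Proof.
elim: s t => [|a s IH] [|b t] //=; rewrite !inE.
by case/orP=> [/eqP[-> _]|/IH ->]; rewrite ?eqxx ?orbT.
Qed.

Lemma mem_zip2 (S T : eqType) (s : seq S) (t : seq T) x y :
  (x, y) \in zip s t -> y \in t.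
Proof.
elim: s t => [|a s IH] [|b t] //=; rewrite !inE.
by case/orP=> [/eqP[_ ->]|/IH ->]; rewrite ?eqxx ?orbT.
Qed.

Lemma mem_full_tuple (V : finType) (s : #|V|.-tuple V) x : uniq s -> x \in s.
Proof.
move=> Us; have cs : #|s| = #|V| by rewrite (card_uniqP Us) size_tuple.
by rewrite (subset_cardP cs (subset_predT _)).
Qed.

(** * A linear order compatible with an acyclic digraph *)

Lemma path_subset_zip (V : finType) (D : {set V * V}) x p y :
  path (fun u v => (u, v) \in D) x p -> (last x p, y) \in D ->
  {subset zip (x :: p) (rcons p y) <= D}.
Proof.
elim: p x => [|b p IH] x /=; first by move=> _ xyD a; rewrite inE => /eqP->.
move=> /andP[xbD bp] lastD a; rewrite inE => /orP[/eqP-> //|].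
exact: IH.
Qed.

(** A walk from [y] back to [x] can be shortened to one without repeated vertices; the arrow
    [(x, y)] then closes it into a cycle. *)
Lemma acyclic_no_closed_walk (V : finType) (D : {set V * V}) x y :
  acyclic D -> (x, y) \in D -> ~~ connect (fun u v => (u, v) \in D) y x.
Proof.
move=> acD xyD; apply/negP=> /connectP[q /shortenP[p yp Up _] lastp].
have szp : size (y :: p) == #|[set v in y :: p]|.
  by rewrite cardsE (card_uniqP Up).
apply: (negP (acD ([set v in y :: p], cycle_arrows (y :: p)))).
apply/andP; split; last first.
  apply/subsetP=> a; rewrite inE rot1_cons; apply: path_subset_zip => //.
  by rewrite -lastp.
apply/andP; split; first by apply/set0Pn; exists y; rewrite !inE eqxx.
by apply/existsP; exists (Tuple szp); rewrite Up /= !eqxx.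
Qed.

Lemma acyclic_rank (V : finType) (D : {set V * V}) : acyclic D ->
  exists2 r : V -> nat, injective r & forall x y, (x, y) \in D -> r y < r x.
Proof.
move=> acD; pose e u v := (u, v) \in D.
pose h x := #|connect e x|.
(* The number of reachable vertices decreases along arrows; ties are broken
   by the enumeration of V. *)
exists (fun x => h x * #|V| + enum_rank x).
  move=> x y eqxy; apply: enum_rank_inj; apply: val_inj => /=.
  have := congr1 (modn^~ #|V|) eqxy.
  by rewrite !modnMDl !modn_small.
move=> x y xyD.
(* Whatever [y] reaches, [x] reaches too, but [y] does not reach [x], so the inclusion is strict. *)
have hyx : h y < h x.
  apply: proper_card; apply/properP; split.
    by apply/subsetP=> z; apply: connect_trans; apply: connect1.
  by exists x; [apply: connect0 | apply: acyclic_no_closed_walk].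
apply: leq_trans (_ : (h y).+1 * #|V| <= _).
  by rewrite mulSnr -addnS leq_add2l ltn_ord.
by apply: leq_trans (leq_addr _ _); rewrite leq_mul2r hyx orbT.
Qed.

(** * Foata's correspondence *)

(* [a] is the current letter, [s] the rest of the word and [f] the first letter
   of the block of [a]; blocks are closed after the right-to-left minima. *)
Fixpoint block_arrows (V : finType) (r : V -> nat) (f a : V) (s : seq V) :
    seq (V * V) :=
  if s is b :: t then
    if all (fun y => r a < r y) s then (a, f) :: block_arrows r b b t
    else (a, b) :: block_arrows r f b t
  else [:: (a, f)].

Definition foata (V : finType) (r : V -> nat) (s : seq V) : seq (V * V) :=
  if s is x :: t then block_arrows r x x t else [::].

Lemma block_arrows_cons (V : finType) (r : V -> nat) f a b t :
  block_arrows r f a (b :: t) =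
  if all (fun y => r a < r y) (b :: t) then (a, f) :: block_arrows r b b t
  else (a, b) :: block_arrows r f b t.
Proof. by []. Qed.

Lemma block_arrows_sources (V : finType) (r : V -> nat) f a s :
  unzip1 (block_arrows r f a s) = a :: s.
Proof. by elim: s f a => //= b t IH f a; case: ifP => _ /=; rewrite IH. Qed.

(** [f] is the one target still owed: closing a block supplies it, and the next letter [b] is then
    owed instead. *)
Lemma block_arrows_targets (V : finType) (r : V -> nat) f a s :
  perm_eq (unzip2 (block_arrows r f a s)) (f :: s).
Proof.
elim: s f a => //= b t IH f a; case: ifP => _ /=; first by rewrite perm_cons.
by rewrite (permPr (permEl (perm_catCA [:: f] [:: b] t))) perm_cons.
Qed.

(** A letter before the minimum [g] is not smaller than all later ones, as [g] is among these; so
    the block starting with [f] closes exactly at [g]. *)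
Lemma block_arrows_min (V : finType) (r : V -> nat) f a s g :
  g \in a :: s -> (forall y, y \in a :: s -> y != g -> r g < r y) ->
  uniq (a :: s) -> (g, f) \in block_arrows r f a s.
Proof.
elim: s a => [|b t IH] a gs ming.
  by move: gs; rewrite /= !inE xpair_eqE eqxx andbT.
rewrite block_arrows_cons => /andP[abt Ubt].
case: ifPn => [/allP ltab|]; rewrite inE.
  suff -> : g = a by rewrite eqxx.
  move: gs; rewrite inE => /orP[/eqP //|/ltab]; have [//|nga] := eqVneq a g.
  by rewrite ltnNge ltnW // ming // mem_head.
move=> nall; have nag : g != a.
  apply: contra nall => /eqP ga; apply/allP=> y yb; rewrite -ga.
  apply: ming; first by rewrite inE yb orbT.
  by apply: contraNneq abt => yg; rewrite -ga -yg.
apply/orP; right; apply: IH => //.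
  by move: gs; rewrite inE (negPf nag).
by move=> y yb; apply: ming; rewrite inE yb orbT.
Qed.

Lemma exists_min_rank (V : finType) (r : V -> nat) (x : V) s : injective r ->
  exists2 g, g \in x :: s & forall y, y \in x :: s -> y != g -> r g < r y.
Proof.
move=> inj_r; case: (@arg_minnP _ x (mem (x :: s)) r (mem_head x s)) => g gs ming.
exists g => // y /ming; rewrite leq_eqVlt => /orP[/eqP/inj_r -> |//].
by rewrite eqxx.
Qed.

(** Whether the block closes at [a] depends only on the set of remaining letters, so both words take
    the same branch. The next letter is then the image of the least remaining letter if the block
    closes, and the image of [a] otherwise. *)
Lemma block_arrows_inj (V : finType) (r : V -> nat) f a s s' :
  injective r -> uniq (a :: s) -> perm_eq s s' ->
  block_arrows r f a s =i block_arrows r f a s' -> s = s'.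
Proof.
move=> inj_r; elim: s s' f a => [|b t IH] s' f a Us ss' eqs.
  by apply/esym/perm_nilP; rewrite perm_sym.
case: s' ss' eqs => [|b' t'] ss' eqs; first by move/perm_nilP: ss'.
have Us' : uniq (a :: b' :: t') 
  by rewrite cons_uniq -(perm_mem ss') -(perm_uniq ss').
have Uarr w f0 a0 : uniq (a0 :: w) -> uniq (block_arrows r f0 a0 w).
  by rewrite -(block_arrows_sources r f0); apply: map_uniq.
(* Both lists are free of repetitions, so having the same members makes them permutations of each
   other, and a common head can be cancelled. *)
have peq : perm_eq (block_arrows r f a (b :: t)) (block_arrows r f a (b' :: t')).
  by apply: uniq_perm => //; apply: Uarr.
move: Us Us' => /andP[abt Ubt] /andP[_ Ubt'].
suff eqb : b = b'.
  move: peq; rewrite -eqb in ss' *; have tt' : perm_eq t t' by rewrite perm_cons in ss'.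
  rewrite !block_arrows_cons -(perm_all _ ss').
  case: ifP => _; rewrite perm_cons => peq.
    by rewrite (IH t' b b Ubt tt' (perm_mem peq)).
  by rewrite (IH t' f b Ubt tt' (perm_mem peq)).
move: peq; rewrite !block_arrows_cons -(perm_all _ ss').
case: ifP => _ peq.
  have [g gs ming] := exists_min_rank b t inj_r.
  move: peq; rewrite perm_cons => /perm_mem eqarr.
  apply: (@mem_pair_inj1 _ _ (block_arrows r b b t) g).
  - by rewrite block_arrows_sources.
  - exact: block_arrows_min.
  - rewrite eqarr; apply: block_arrows_min => //; first by rewrite -(perm_mem ss').
    by move=> y; rewrite -(perm_mem ss'); apply: ming.
apply: (@mem_pair_inj1 _ _ ((a, b) :: block_arrows r f b t) a).
- by rewrite [unzip1 _]/= block_arrows_sources cons_uniq abt.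
- exact: mem_head.
- by rewrite (perm_mem peq) mem_head.
Qed.

Lemma foata_inj (V : finType) (r : V -> nat) s s' :
  injective r -> uniq s -> perm_eq s s' -> foata r s =i foata r s' -> s = s'.
Proof.
case: s s' => [|x t] [|x' t'] inj_r Us ss' eqs //=.
- by have := perm_size ss'.
- by have := perm_size ss'.
have Us' : uniq (x' :: t') by rewrite -(perm_uniq ss').
(* The global minimum closes the first block, so its image is the first letter. *)
have [g gs ming] := exists_min_rank x t inj_r.
have eqx : x = x'.
  apply: (@mem_pair_inj1 _ _ (block_arrows r x x t) g).
  - by rewrite block_arrows_sources.
  - exact: block_arrows_min.
  - rewrite (eqs (g, x')); apply: block_arrows_min => //; first by rewrite -(perm_mem ss').
    by move=> y; rewrite -(perm_mem ss'); apply: ming.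
move: ss' eqs; rewrite -eqx perm_cons => tt' eqs.
by rewrite (block_arrows_inj inj_r Us tt' eqs).
Qed.

(* The two arrow lists differ only in arrows along which r does not decrease. *)
Lemma block_arrows_on (V : finType) (r : V -> nat) (E : {set V * V}) f a s :
  (forall x y, r x <= r y -> (x, y) \in E) ->
  has (fun y => r y <= r f) (a :: s) ->
  all (mem E) (block_arrows r f a s) = all (mem E) (zip (a :: s) s).
Proof.
move=> upE; elim: s f a => [|b t IH] f a; first by rewrite /= orbF => /upE ->.
rewrite block_arrows_cons.
rewrite -[has _ _]/((r a <= r f) || has (fun y => r y <= r f) (b :: t)).
(* If the block closes at [a], every later letter has larger rank, so the [has] hypothesis forces
   [r a <= r f]. *)
case: ifPn => [ltab|nall] lef; rewrite [LHS]/= [RHS]/=.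
  rewrite IH /= ?leqnn // (upE a b) ?(upE a f) //.
    case/orP: lef => // /hasP[y /(allP ltab) ay yf].
    exact: ltnW (leq_trans ay yf).
  by case/andP: ltab => /ltnW.
(* Otherwise some later letter has rank at most [r a], and it can replace [a] as the witness for
   [f]. *)
congr (_ && _); apply: IH; case/orP: lef => // af.
move: nall; rewrite -has_predC => /hasP[y yb]; rewrite -[predC _ y]/(~~ (r a < r y)) -leqNgt => ya.
by apply/hasP; exists y => //; apply: leq_trans af.
Qed.

Lemma foata_on (V : finType) (r : V -> nat) (E : {set V * V}) s :
  (forall x y, r x <= r y -> (x, y) \in E) ->
  all (mem E) (foata r s) = all (mem E) (zip s (behead s)).
Proof. by case: s => // x t upE; apply: block_arrows_on; rewrite //= leqnn. Qed.

(** * Graphs of permutations and cycle covers *)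

Definition perm_graph (V : finType) (p : {perm V}) : {set V * V} :=
  [set a | p a.1 == a.2].

Lemma perm_graph_inj (V : finType) : injective (@perm_graph V).
Proof.
move=> p q eqpq; apply/permP=> x; apply/esym/eqP.
by have /setP/(_ (x, p x)) := eqpq; rewrite !inE eqxx => /esym.
Qed.

Lemma perm_graphP (V : finType) (A : {set V * V}) :
  (forall x, exists y, (x, y) \in A) ->
  (forall x x' y, (x, y) \in A -> (x', y) \in A -> x = x') ->
  exists p, A = perm_graph p.
Proof.
move=> totA injA.
pose f x := xchoose (totA x).
have fA x : (x, f x) \in A by apply: (xchooseP (totA x)).
have inj_f : injective f.
  by move=> x y eqf; apply: (injA _ _ (f x)); rewrite ?fA // eqf.
exists (perm inj_f); apply/setP=> [[x y]]; rewrite inE permE /=.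
apply/idP/eqP=> [xyA|<- //].
(* An injective [f] on a finite type is onto, so [y] has a preimage [u], which [injA] identifies
   with [x]. *)
have [u yu] : exists u, y = f u by exists (invF inj_f y); rewrite f_invF.
by rewrite yu; congr f; apply: (injA _ _ y); rewrite // yu.
Qed.

Lemma card_perm_graphs (V : finType) :
  #|[set perm_graph p | p : {perm V}]| = #|V|`!.
Proof.
rewrite (card_imset _ (@perm_graph_inj V)) -cardsT -card_perm.
by apply: eq_card => p; rewrite !inE; apply/esym/subsetP.
Qed.

Lemma foata_perm_graph (V : finType) (r : V -> nat) (s : #|V|.-tuple V) :
  uniq s -> [set a in foata r s] \in [set perm_graph p | p : {perm V}].
Proof.
move=> Us; suff [p ->] : exists p, [set a in foata r s] = perm_graph p.
  exact: imset_f.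
have src : unzip1 (foata r s) = s.
  by case: (tval s) => //= x t; rewrite block_arrows_sources.
have tgt : uniq (unzip2 (foata r s)).
  by case: (tval s) Us => //= x t; rewrite (perm_uniq (block_arrows_targets _ _ _ _)).
apply: perm_graphP => [x|x x' y]; last by rewrite !inE; apply: mem_pair_inj2.
have /mapP[[u y] uy /= ->] : x \in unzip1 (foata r s).
  by rewrite src; apply: mem_full_tuple.
by exists y; rewrite inE.
Qed.

Lemma cycle_on_perm_graph (V : finType) (D : {set V * V}) (p : {perm V}) x :
  perm_graph p \subset D ->
  cycle_on D (porbit p x, [set a in perm_graph p | a.1 \in porbit p x]).
Proof.
move=> /subsetP pD; apply/andP; split; last first.
  by apply/subsetP=> a; rewrite inE => /andP[/pD].
apply/andP; split; first by apply/set0Pn; exists x; apply: porbit_id.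
apply/existsP; exists (Tuple (introT eqP (size_traject p x #|porbit p x|))).
rewrite uniq_traject_porbit /=; apply/andP; split.
  by apply/eqP/setP=> y; rewrite porbit_traject inE.
apply/eqP/setP=> [[y z]]; rewrite !inE porbit_traject.
(* [p] maps the listed orbit to its rotation because it returns to [x] after [#|porbit p x|]
   steps. *)
have -> : rot 1 (traject p x #|porbit p x|) = map p (traject p x #|porbit p x|).
  have mapT n u : map p (traject p u n) = traject p (p u) n.
    by elim: n u => //= n IH u; rewrite IH.
  have := iter_porbit p x; case: #|porbit p x| => // n itn.
  by rewrite mapT [RHS]trajectSr -iterSr itn trajectS rot1_cons.
elim: (traject _ _ _) => [|u s IH] /=; first by rewrite andbF.
rewrite !inE -IH andb_orr xpair_eqE; congr (_ || _).
by apply/andP/andP=> [[/eqP<- /eqP->]|[/eqP-> /eqP->]].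
Qed.

(** Replaces the decomposition [P] by a condition on the arrow set alone: the arrows of a cover form
    the graph of its successor map, and conversely the orbits of a permutation provide [P]. *)
Lemma cycle_cover_perm_graph (V : finType) (D : {set V * V}) (S : subdigraph V) :
  cycle_cover_of D S =
  [&& S.1 == [set: V], S.2 \subset D & S.2 \in [set perm_graph p | p : {perm V}]].
Proof.
rewrite /cycle_cover_of; case: eqP => //= ST; case SD: (S.2 \subset D) => //=.
apply/existsP/imsetP=> [[P /and4P[/forall_inP cycP /forallP coverP _ /eqP S2]]|[p _ S2]].
  suff [p Sp] : exists p, S.2 = perm_graph p by exists p.
  have cyc C : C \in P -> exists s, [/\ uniq s, C.1 = [set v in s] & C.2 = cycle_arrows s].
    by move=> /cycP/andP[/andP[_ /existsP[s /and3P[Us /eqP C1 /eqP C2]]] _]; exists s.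
  apply: perm_graphP => [x|x x' y]; rewrite S2.
    have /cards1P[C] := coverP x; move/setP/(_ C); rewrite !inE eqxx.
    case/andP=> CP; have [s [Us C1 C2]] := cyc C CP.
    rewrite C1 inE => xs.
    have : x \in unzip1 (zip s (rot 1 s)) by rewrite unzip1_zip ?size_rot.
    case/mapP=> [[u y] uy /= ->]; exists y; apply/bigcupP; exists C => //.
    by rewrite C2 inE.
  case/bigcupP=> C CP xC /bigcupP[C' CP' xC'].
  have tgt B z : B \in P -> (z, y) \in B.2 -> y \in B.1.
    case/cyc=> s [_ -> ->]; rewrite !inE => /mem_zip2; by rewrite mem_rot.
  (* Both arrows into [y] lie on cycles through [y], and [P] has only one such cycle. *)
  have eqC : C' = C.
    have /cards1P[B eqB] := coverP y.
    have inB E : E \in P -> y \in E.1 -> E = B.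
      by move=> EP yE; apply/set1P; rewrite -eqB inE EP.
    by rewrite (inB C CP (tgt C x CP xC)) (inB C' CP' (tgt C' x' CP' xC')).
  move: xC xC'; rewrite eqC; have [s [Us _ ->]] := cyc C CP; rewrite !inE.
  by apply: mem_pair_inj2; rewrite unzip2_zip ?size_rot ?rot_uniq.
pose F x : subdigraph V := (porbit p x, [set a in perm_graph p | a.1 \in porbit p x]).
have Fp x : x \in (F x).1 by apply: porbit_id.
exists [set F x | x : V]; apply/and4P; split.
- apply/forall_inP=> C /imsetP[x _ ->]; apply: cycle_on_perm_graph.
  by rewrite -S2.
- apply/forallP=> v; apply/cards1P; exists (F v); apply/setP=> C; rewrite !inE.
  apply/andP/eqP=> [[/imsetP[x _ ->]]|->]; last by rewrite imset_f ?Fp.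
  by rewrite /= -eq_porbit_mem => /eqP vx; rewrite /F vx.
- rewrite ST eqEsubset subsetT andbT; apply/subsetP=> x _.
  by apply/bigcupP; exists (F x); rewrite ?imset_f ?Fp.
- rewrite S2 eqEsubset; apply/andP; split; apply/subsetP=> a.
    move=> ap; apply/bigcupP; exists (F a.1); rewrite ?imset_f //.
    by rewrite inE ap Fp.
  by case/bigcupP=> C /imsetP[x _ ->]; rewrite inE => /andP[].
Qed.

(** * Hamiltonian paths as words *)

(** The first letter is the only one that is not the target of an arrow; deleting the arrow that
    leaves it gives the induction. *)
Lemma path_arrows_inj (V : finType) (s s' : seq V) :
  uniq s -> perm_eq s s' -> path_arrows s = path_arrows s' -> s = s'.
Proof.
elim: s s' => [|x p IH] [|x' p'] // Us ss' eqs.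
- by have := perm_size ss'.
- by have := perm_size ss'.
have Us' : uniq (x' :: p') by rewrite -(perm_uniq ss').
have tgt (z y : V) w : y \in w -> exists u, (u, y) \in path_arrows (z :: w).
  move=> yw; have : y \in unzip2 (zip (z :: w) w) by rewrite unzip2_zip /=.
  by case/mapP=> [[u v] uv /= ->]; exists u; rewrite inE.
have eqx : x = x'.
  apply/eqP; apply: contraT => nxx'.
  have xp' : x \in p'.
    by have := mem_head x p; rewrite (perm_mem ss') inE (negPf nxx').
  have [u] := tgt x' x p' xp'; rewrite -eqs inE => /mem_zip2 xp.
  by move: Us; rewrite /= xp.
move: ss' Us' eqs; rewrite -eqx perm_cons => pp' /andP[xp' Up'] eqs.
move: Us => /andP[xp Up]; congr (_ :: _); apply: IH => //.
have strip w : x \notin w ->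
    path_arrows w = [set a in path_arrows (x :: w) | a.1 != x].
  case: w => [|b w] xw; apply/setP=> [[u v]]; rewrite !inE //=.
  rewrite xpair_eqE; have [->|_] := eqVneq u x; last by rewrite andbT.
  rewrite andbF.
  by apply/negP=> /mem_zip1; rewrite (negPf xw).
by rewrite (strip p xp) (strip p' xp') eqs.
Qed.

Lemma hamiltonian_pathE (V : finType) (D : {set V * V}) (S : subdigraph V) :
  hamiltonian_path_on D S <->
  exists s : #|V|.-tuple V,
    [/\ uniq s, path_arrows s \subset D & S = ([set: V], path_arrows s)].
Proof.
case: S => S1 S2; split=> [/andP[/andP[/existsP[s]]]|[s [Us sD [-> ->]]]] /=.
  case/and3P=> Us _ /eqP-> sD /eqP S1T.
  have szs : size s == #|V| by rewrite size_tuple S1T cardsT.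
  by exists (Tuple szs); split=> //; congr pair.
rewrite /hamiltonian_path_on /path_on /= sD eqxx !andbT /is_path /=.
apply/existsP.
have szs : size s == #|[set: V]| by rewrite size_tuple cardsT.
exists (Tuple szs); rewrite Us /= eqxx andbT; apply/eqP/setP=> x.
by rewrite !inE; apply/esym/(mem_full_tuple x Us).
Qed.

(** * Counting both families by words *)

Theorem theorem2p1 (V : finType) (D : {set V * V}) (acyclicD : acyclic D) :
  #|[set S : subdigraph V | hamiltonian_path_on (complement D) S]| =
  #|[set S : subdigraph V | cycle_cover_of (complement D) S]|.
Proof.
have [r inj_r rD] := acyclic_rank acyclicD.
have upE x y : r x <= r y -> (x, y) \in complement D.
  by rewrite inE leqNgt; apply: contra; apply: rD.
set E := complement D in upE *.
pose words := [set s : #|V|.-tuple V | uniq s].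
pose graphs := [set perm_graph p | p : {perm V}].
pose phi (s : #|V|.-tuple V) := [set a in foata r s].
have perm_words (s t : #|V|.-tuple V) : s \in words -> t \in words -> perm_eq s t.
  rewrite !inE => Us Ut; apply: uniq_perm => // x.
  by rewrite !mem_full_tuple.
have phi_inj : {in words &, injective phi}.
  move=> s t sW tW /setP eqst; apply/val_inj/(foata_inj inj_r) => //.
  - by rewrite inE in sW.
  - exact: perm_words.
  - by move=> a; have := eqst a; rewrite !inE.
have phi_words : phi @: words = graphs.
  apply/eqP; rewrite eqEcard; apply/andP; split.
    apply/subsetP=> _ /imsetP[s sW ->].
    by apply: foata_perm_graph; rewrite inE in sW.
  (* The words without repetition number [#|V| ^_ #|V|], a falling factorial equal to [#|V|!]. *)
  rewrite card_perm_graphs card_in_imset // -ffactnn -(card_uniq_tuples #|V| predT).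
  by apply: subset_leq_card; apply/subsetP=> s; rewrite !inE => /andP[].
have phi_on s : (phi s \subset E) = (path_arrows s \subset E).
  have subE l : ([set a in l] \subset E) = all (mem E) l.
    by apply/subsetP/allP=> lE a al; apply: lE; rewrite inE in al *.
  by rewrite !subE foata_on.
(* Both families are injective images of this one set of words, under [ham] and [cover]. *)
pose good := [set s in words | path_arrows (tval s) \subset E].
pose ham (s : #|V|.-tuple V) : subdigraph V := ([set: V], path_arrows s).
pose cover (s : #|V|.-tuple V) : subdigraph V := ([set: V], phi s).
have -> : [set S | hamiltonian_path_on E S] = ham @: good.
  apply/setP=> S; rewrite inE; apply/idP/imsetP.
    by case/hamiltonian_pathE=> s [Us sE ->]; exists s; rewrite // !inE Us.
  case=> s; rewrite !inE => /andP[Us sE] ->.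
  by apply/hamiltonian_pathE; exists s.
have -> : [set S | cycle_cover_of E S] = cover @: good.
  apply/setP=> [[S1 S2]]; rewrite inE cycle_cover_perm_graph -/graphs -phi_words /=.
  apply/and3P/imsetP=> [[/eqP-> SE /imsetP[s sW Ss]]|[s]].
    by exists s; rewrite /cover -?Ss // inE sW -phi_on -Ss.
  by rewrite inE -phi_on => /andP[sW sE] [-> ->]; rewrite eqxx imset_f.
rewrite !card_in_imset //.
  move=> s t; rewrite inE => /andP[sW _]; rewrite inE => /andP[tW _] [].
  exact: phi_inj.
move=> s t; rewrite inE => /andP[sW _]; rewrite inE => /andP[tW _] [eqst].
by apply/val_inj/(path_arrows_inj _ (perm_words _ _ sW tW) eqst); rewrite inE in sW.
Qed.
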